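(* Let $R$ be a unital ring with identity $1$ in which the element $2$ is invertible, and let $t \in R$. The following assertions are equivalent: (i) $t$ is a commutator of a pair of idempotents in $R$, i.e. there exist idempotents $p, q \in R$ with $t = pq - qp$; (ii) $4t$ is a commutator of a pair of involutions in $R$, i.e. there exist involutions $u, v \in R$ with $4t = uv - vu$; (iii) there exist $u \in R$ and $s \in R$ such that $u^2 = 1$, $ut + tu = 0$, $us = su$, $st = ts$ and $s^2 = t^2 + 1/4$.
   Context: $R$ is not assumed commutative. An idempotent in $R$ is an element $p$ with $p^2 = p$; an involution in $R$ is an element $u$ with $u^2 = 1$. The commutator of $a, b \in R$ is $[a,b] := ab - ba$. Here $2 = 1 + 1$, $4 = 2 \cdot 2$, and $1/4$ denotes the inverse of $4$ in $R$. *)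

(* Defs.v *)
From mathcomp Require Import all_boot all_algebra.

Set Implicit Arguments.
Unset Strict Implicit.
Unset Printing Implicit Defensive.

Import GRing.Theory.
Local Open Scope ring_scope.

(* Rings are [pzRingType]s: unital, not necessarily commutative, and possibly
   zero.  MathComp's [GRing.unit] and [_^-1] require [0 != 1] and a chosen
   inverse operation, so invertibility is spelled out as a two-sided inverse. *)

Definition is_inverse (R : pzRingType) (a b : R) : Prop := a * b = 1 /\ b * a = 1.

Definition invertible (R : pzRingType) (a : R) : Prop := exists b, is_inverse a b.

Definition is_idempotent (R : pzRingType) (p : R) : Prop := p ^+ 2 = p.

Definition is_involution (R : pzRingType) (u : R) : Prop := u ^+ 2 = 1.

Definition commutator (R : pzRingType) (a b : R) : R := a * b - b * a.

Lemma is_inverse_unique (R : pzRingType) (a b c : R) :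
  is_inverse a b -> is_inverse a c -> b = c.
Proof.
by move=> [_ ba1] [ac1 _]; rewrite -[b]mulr1 -ac1 mulrA ba1 mul1r.
Qed.

Lemma invertible4 (R : pzRingType) : invertible (2 : R) -> invertible (4 : R).
Proof.
move=> [b [b1 b2]]; exists (b * b); rewrite (natrM R 2 2); split.
  by rewrite mulrA -(mulrA 2) b1 mulr1 b1.
by rewrite mulrA -(mulrA b) b2 mulr1 b2.
Qed.

(* Main.v *)
Require Import Defs.
From mathcomp Require Import all_boot all_algebra.

(** The substitution [u = 2 p - 1] is a bijection from idempotents to
    involutions (bijective because [2] is invertible), and it multiplies
    commutators by [4]; so the first two assertions are the same
    ([idempotent_involution], [commutator_reflection]).

    For involutions [u] and [v], all the information on [v] is carried by
    [u v], whose inverse is [v u].  Put [S = u v + v u] and [T = u v - v u].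
    Conjugation by [u] exchanges [u v] and [v u], hence fixes [S] and negates
    [T]; the elements [S] and [T] commute because [u v] and [v u] do; and
    [S^2 - T^2 = (S - T) (S + T) = (2 v u) (2 u v) = 4].  Dividing by [4], the
    elements [s = S / 4] and [t = T / 4] satisfy the relations of the third
    assertion.

    Conversely these relations determine [v], since [u v = (S + T) / 2] has to
    be [2 (s + t)], i.e. [v = 2 u (s + t)].  As [u] fixes [s] and negates [t],
    [u (s + t) u = s - t], so that [v^2 = 4 (s - t) (s + t) = 1] and
    [u v - v u = 2 (s + t) - 2 (s - t) = 4 t]. *)

Import GRing.Theory.
Local Open Scope ring_scope.

(** * Invertible integers *)

Lemma mulrn_inj_of_inverse (R : pzRingType) (n : nat) (c : R) :
  is_inverse n%:R c -> injective (fun x : R => x *+ n).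
Proof.
move=> [_ cn1] x y /= eq_xy.
by rewrite -[x]mul1r -[y]mul1r -cn1 -!mulrA !mulr_natl eq_xy.
Qed.

Lemma mulrn_divK (R : pzRingType) (n : nat) (c x : R) :
  is_inverse n%:R c -> (c * x) *+ n = x.
Proof. by move=> [nc1 _]; rewrite -mulr_natl mulrA nc1 mul1r. Qed.

(** * Idempotents and involutions *)

Lemma reflection_sqr (R : pzRingType) (p : R) :
  (p *+ 2 - 1) ^+ 2 - 1 = (p ^+ 2 - p) *+ 4.
Proof.
rewrite sqrrB1 addrK exprMn_n mulrnBl -!mulrnA.
by congr (_ - _).
Qed.

Lemma idempotent_involution (R : pzRingType) (c p : R) : is_inverse 4 c ->
  is_idempotent p <-> is_involution (p *+ 2 - 1).
Proof.
move=> cP; split=> [pp | /eqP].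
  by apply/eqP; rewrite -subr_eq0 reflection_sqr pp subrr mul0rn.
rewrite -subr_eq0 reflection_sqr => /eqP p4.
by apply/subr0_eq/(mulrn_inj_of_inverse _ _ _ cP); rewrite p4 mul0rn.
Qed.

Lemma commutator_reflection (R : pzRingType) (p q : R) :
  commutator (p *+ 2 - 1) (q *+ 2 - 1) = commutator p q *+ 4.
Proof.
have subl (a b : R) : commutator (a - 1) b = commutator a b.
  by rewrite /commutator mulrBl mulrBr mul1r mulr1 opprB addrA subrK.
have subr (a b : R) : commutator a (b - 1) = commutator a b.
  by rewrite /commutator mulrBl mulrBr mul1r mulr1 opprB addrA subrK.
by rewrite subl subr /commutator !mulrnAl !mulrnAr -!mulrnA mulrnBl.
Qed.

(** * Commutators of involutions *)

Lemma subr_sqr_comm (R : pzRingType) (a b : R) : a * b = b * a ->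
  a ^+ 2 - b ^+ 2 = (a - b) * (a + b).
Proof. by move=> ab; rewrite mulrBl !mulrDr ab opprD addrA addrK -!expr2. Qed.

(** Conjugation by [u] exchanges [u v] and its inverse [v u], and
    [S - T = 2 v u], [S + T = 2 u v] multiply to [4].  With [S = 4 s] and
    [T = 4 t], this is the third assertion cleared of denominators, a form in
    which no scalar has to be moved across a product. *)
Lemma involution_pair_relations (R : pzRingType) (u v : R) :
    is_involution u -> is_involution v ->
  let S := u * v + v * u in let T := commutator u v in
  [/\ u * T + T * u = 0, u * S = S * u, S * T = T * S & S ^+ 2 = T ^+ 2 + 4].
Proof.
move=> + + S T; rewrite /is_involution [u ^+ 2]expr2 [v ^+ 2]expr2 => uu vv.
have uuv : u * (u * v) = v by rewrite mulrA uu mul1r.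
have vuu : (v * u) * u = v by rewrite -mulrA uu mulr1.
have uvvu : (u * v) * (v * u) = 1 by rewrite mulrA -(mulrA u) vv mulr1.
have vuuv : (v * u) * (u * v) = 1 by rewrite mulrA -(mulrA v) uu mulr1.
have ST : S * T = T * S.
  have uv_vu : GRing.comm (u * v) (v * u) by rewrite /GRing.comm uvvu.
  by apply: commrB; apply/commr_sym/commrD => //; apply: commr_sym.
have subST : S - T = (v * u) *+ 2.
  by rewrite /S /T opprB addrC addrA subrK -mulr2n.
have addST : S + T = (u * v) *+ 2.
  by rewrite /S /T /commutator addrACA subrr addr0 -mulr2n.
split=> //.
- by rewrite mulrBr mulrBl uuv vuu mulrA addrA subrK subrr.
- by rewrite mulrDr mulrDl uuv vuu mulrA addrC.
- apply/eqP; rewrite addrC -subr_eq subr_sqr_comm // subST addST.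
  by rewrite mulrnAl mulrnAr vuuv -mulrnA.
Qed.

Lemma relations_of_involutions (R : pzRingType) (c t u v : R) :
    is_inverse 4 c -> is_involution u -> is_involution v ->
    t *+ 4 = commutator u v ->
  exists s, [/\ u * t + t * u = 0, u * s = s * u, s * t = t * s
              & s ^+ 2 = t ^+ 2 + c].
Proof.
move=> cP uu vv t4.
have inj4 := mulrn_inj_of_inverse _ _ _ cP.
have [] := involution_pair_relations _ _ _ uu vv; rewrite -t4 /=.
rewrite -(mulrn_divK _ _ _ (u * v + v * u) cP); move: (c * _) => s.
rewrite !(mulrnAl, mulrnAr) -mulrnDl => ut us st ss.
exists s; split; first by apply: inj4; rewrite ut mul0rn.
- exact: inj4.
- exact/inj4/inj4.
(* The square multiplies the denominator [4] twice, and [16 c = 4]. *)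
- apply/inj4/inj4 => /=; move: ss; rewrite !exprMn_n => ss.
  rewrite -!mulrnA [LHS]ss !mulrnDl.
  have c4 : c *+ 4 = 1 by rewrite -[c]mulr1 (mulrn_divK _ _ _ _ cP).
  by rewrite [c *+ _]mulrnA c4.
Qed.

(** The choice of [v] is forced: [u v] is half of [(u v + v u) + (u v - v u)],
    that is of [4 s + 4 t]. *)
Lemma involutions_of_relations (R : pzRingType) (c t u s : R) :
    is_inverse 4 c -> is_involution u ->
    u * t + t * u = 0 -> u * s = s * u -> s * t = t * s ->
    s ^+ 2 = t ^+ 2 + c ->
  let v := (u * (s + t)) *+ 2 in is_involution v /\ t *+ 4 = commutator u v.
Proof.
move=> cP + ut us st ss v; rewrite /is_involution [u ^+ 2]expr2 => uu.
have conj_u : u * (s + t) * u = s - t.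
  by rewrite -mulrA mulrDl -us -(addr0_eq ut) -mulrBr mulrA uu mul1r.
have st_c : (s - t) * (s + t) = c.
  by rewrite -subr_sqr_comm // ss addrAC subrr add0r.
split.
  rewrite exprMn_n expr2 mulrA conj_u st_c -[c]mulr1.
  exact: mulrn_divK cP.
rewrite /commutator /v mulrnAr mulrnAl conj_u mulrA uu mul1r -mulrnBl.
by rewrite opprB addrC addrA subrK -mulr2n -mulrnA.
Qed.

Theorem theorem2p1 (R : pzRingType) (two_inv : invertible (2 : R))
    (quarter : R) (quarterP : is_inverse (4 : R) quarter) (t : R) :
  [<-> (exists p q : R,
          [/\ is_idempotent p, is_idempotent q & t = commutator p q]);
       (exists u v : R,
          [/\ is_involution u, is_involution v & 4 * t = commutator u v]);
       (exists u s : R,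
          [/\ u ^+ 2 = 1, u * t + t * u = 0, u * s = s * u, s * t = t * s
            & s ^+ 2 = t ^+ 2 + quarter])].
Proof.
have idemP p := idempotent_involution _ _ p quarterP.
rewrite mulr_natl; tfae.
- move=> [p [q [/idemP pp /idemP qq ->]]].
  exists (p *+ 2 - 1), (q *+ 2 - 1).
  by rewrite commutator_reflection.
- move=> [u [v [uu vv t4]]].
  have [s [ut us st ss]] := relations_of_involutions _ _ _ _ _ quarterP uu vv t4.
  by exists u, s.
- move=> [u [s [uu ut us st ss]]].
  have [] := involutions_of_relations _ _ _ _ _ quarterP uu ut us st ss.
  move: (_ *+ 2) => v vv t4.
  have [h hP] := two_inv.
  have reflK x : (h * (x + 1)) *+ 2 - 1 = x.
    by rewrite (mulrn_divK _ _ _ _ hP) addrK.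
  exists (h * (u + 1)), (h * (v + 1)); split; try by apply/idemP; rewrite reflK.
  apply: (mulrn_inj_of_inverse _ _ _ quarterP).
  by rewrite -commutator_reflection !reflK.
Qed.
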